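(* Let $k$ be a field of prime characteristic $p$ and $$R=\frac{k[t,u,v,x,y]}{(u^2x^2+tuxvy+v^2y^2)}.$$ Then the set $$\bigcup_{q=p^e}\operatorname{Ass}\frac{R}{(u^q,v^q,x^q,y^q)}$$ is infinite.
   Context: The union is over all powers $q=p^e$ of $p$. $\operatorname{Ass} M$ denotes the set of associated primes of the $R$-module $M$. *)

(* Defs.v *)
From HB Require Import structures.
From mathcomp Require Import all_boot all_order all_algebra.
From mathcomp Require Import boolp classical_sets cardinality.
From mathcomp Require Import mpoly.

Set Implicit Arguments.
Unset Strict Implicit.
Unset Printing Implicit Defensive.

Import GRing.Theory.
Local Open Scope ring_scope.
Local Open Scope quotient_scope.
Local Open Scope classical_set_scope.

Section QuotientModule.
Variables (R : nzRingType) (V : lmodType R) (U : submodClosed V).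

(* [submodClosed] does not inherit from [zmodClosed], which [Quotient.quot]
   requires; the alias carries that structure. *)
Definition submod_pred : {pred V} := U.

Lemma submod_pred_zmod : zmod_closed submod_pred.
Proof.
rewrite /submod_pred; split=> [|v w Uv Uw]; first exact: rpred0.
by rewrite -scaleN1r rpredD ?rpredZ.
Qed.

HB.instance Definition _ :=
  GRing.isZmodClosed.Build V submod_pred submod_pred_zmod.

Definition submod_quot := Quotient.quot submod_pred.

HB.instance Definition _ := GRing.Zmodule.on submod_quot.
HB.instance Definition _ := ZmodQuotient.on submod_quot.

Local Notation Q := submod_quot.

Definition quot_scale (a : R) (q : Q) : Q := \pi_Q (a *: repr q).

Lemma pi_scale (a : R) : {morph \pi_Q : v / a *: v >-> quot_scale a v}.
Proof.
move=> v; apply/eqP; rewrite -Quotient.idealrBE -scalerBr.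
rewrite /submod_pred rpredZ // -[_ \in _]/(_ \in submod_pred).
by rewrite Quotient.idealrBE reprK.
Qed.

Lemma quot_scaleA a b (q : Q) :
  quot_scale a (quot_scale b q) = quot_scale (a * b) q.
Proof. by rewrite -[q]reprK -(pi_scale b) -!pi_scale scalerA. Qed.

Lemma quot_scale1 : left_id 1 quot_scale.
Proof. by move=> q; rewrite -[q]reprK -pi_scale scale1r. Qed.

Lemma quot_scaleDr : right_distributive quot_scale +%R.
Proof.
move=> a q r; rewrite -[q]reprK -[r]reprK -raddfD -!pi_scale -raddfD.
by rewrite scalerDr.
Qed.

Lemma quot_scaleDl (q : Q) : {morph quot_scale^~ q : a b / a + b}.
Proof. by move=> a b /=; rewrite -[q]reprK -!pi_scale -raddfD scalerDl. Qed.

HB.instance Definition _ :=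
  GRing.Zmodule_isLmodule.Build R Q
    quot_scaleA quot_scale1 quot_scaleDr quot_scaleDl.

End QuotientModule.

Section IdealGen.
Variable R : comNzRingType.

Definition ideal_gen (s : seq R) : {pred R} :=
  fun x => `[< exists c : 'I_(size s) -> R, x = \sum_i c i * s`_i >].

Lemma ideal_genP (s : seq R) x :
  reflect (exists c : 'I_(size s) -> R, x = \sum_i c i * s`_i)
          (x \in ideal_gen s).
Proof. exact: asboolP. Qed.

Lemma ideal_gen_submod (s : seq R) :
  submod_closed (ideal_gen s : {pred R^o}).
Proof.
split=> [|a x y /ideal_genP[c ->] /ideal_genP[d ->]]; apply/ideal_genP.
  by exists (fun=> 0); rewrite big1 // => i _; rewrite mul0r.
exists (fun i => a * c i + d i); rewrite scaler_sumr -big_split /=.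
by apply: eq_bigr => i _; rewrite mulrDl -mulrA.
Qed.

(* [ideal_gen s] as a submodule of the regular module [R^o]. *)
Definition ideal_submod (s : seq R) : {pred R^o} := ideal_gen s.

HB.instance Definition _ (s : seq R) :=
  GRing.isSubmodClosed.Build R R^o (ideal_submod s) (ideal_gen_submod s).

(* [R / (s)] as an [R]-module. Unlike [{ideal_quot _}], this does not require
   the ideal [(s)] to be proper. *)
Definition quot_module (s : seq R) : lmodType R :=
  submod_quot (ideal_submod s).

End IdealGen.

Section AssociatedPrimes.
Variables (R : comNzRingType) (M : lmodType R).

Definition ann (m : M) : {pred R} := fun r => r *: m == 0.

Definition prime_ideal (P : {pred R}) : Prop :=
  idealr_closed P /\ prime_idealr_closed P.

Definition Ass : set {pred R} :=
  [set P | prime_ideal P /\ exists m : M, P = ann m].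

End AssociatedPrimes.

Section Hypersurface.
Variable k : fieldType.
Local Notation A := {mpoly k[5]}.

Definition tA : A := 'X_(@Ordinal 5 0%N isT).
Definition uA : A := 'X_(@Ordinal 5 1%N isT).
Definition vA : A := 'X_(@Ordinal 5 2%N isT).
Definition xA : A := 'X_(@Ordinal 5 3%N isT).
Definition yA : A := 'X_(@Ordinal 5 4%N isT).

Definition hyp_eq : A :=
  uA ^+ 2 * xA ^+ 2 + tA * uA * xA * vA * yA + vA ^+ 2 * yA ^+ 2.

Definition hyp_ideal : {pred A} := ideal_gen [:: hyp_eq].

Lemma hyp_idealr_closed : idealr_closed hyp_ideal.
Proof.
have [id0 idD] := ideal_gen_submod [:: hyp_eq].
split=> //.
apply/negP => /ideal_genP[c /(congr1 (meval (fun=> 0 : k)))].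
rewrite rmorph1 rmorph_sum big1 => [/eqP|i _]; first by rewrite oner_eq0.
rewrite [i]ord1 /= /hyp_eq mevalM !mevalD !mevalM !mevalXU.
by rewrite !(mulr0, mul0r, expr0n, addr0).
Qed.

HB.instance Definition _ := isIdealr.Build A hyp_ideal hyp_idealr_closed.

Definition hyp_ring : comNzRingType := {ideal_quot hyp_ideal}.

Definition uR : hyp_ring := \pi_(hyp_ring) uA.
Definition vR : hyp_ring := \pi_(hyp_ring) vA.
Definition xR : hyp_ring := \pi_(hyp_ring) xA.
Definition yR : hyp_ring := \pi_(hyp_ring) yA.

End Hypersurface.

(* Main.v *)
Require Import Defs.
From HB Require Import structures.
From mathcomp Require Import all_boot all_order all_algebra.
From mathcomp Require Import boolp classical_sets cardinality.
From mathcomp Require Import mpoly ssrcomplements zify.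

(** Give [t] degree [0]; the equation [f = u^2 x^2 + t u x v y + v^2 y^2] is
    then homogeneous for a multigrading in which [u x] and [v y] have the same
    degree, so [R / (u^q, v^q, x^q, y^q)] splits into graded pieces that are
    modules over [k[t]].  For [n < q], the piece of
    [w = u^(q-n) v^(q-n) (u x)^n] is generated by the monomials
    [e_i = u^(q-n) v^(q-n) (u x)^i (v y)^(n-i)] for [0 <= i <= n].  In it
    [e_0] and [e_n] vanish, since they contain [v^q] and [u^q], and the
    multiples of [f] become the three-term recurrence [e_(i+2) + t e_(i+1) + e_i = 0].
    Hence [e_i = Q_i e_1], where [Q_0 = 0], [Q_1 = 1] and
    [Q_(i+2) = - t Q_(i+1) - Q_i] are Chebyshev polynomials of the second kind
    evaluated at [- t / 2], and the piece is [k[t] / (Q_n)], generated by [e_1].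

    Two facts make [e_1] produce associated primes.  It is killed by [u], [v],
    [x], [y] ([chain_socle]), so a polynomial acts on it through its restriction
    to the [t]-axis.  Its annihilator in [k[t]] is exactly [(Q_n)]: one
    inclusion is [Q_n e_1 = e_n = 0] ([chain_annihilator]), and for the other a
    [k[t]]-linear functional [detect] sends [e_1] to [1] and the ideal
    [(f, u^q, v^q, x^q, y^q)] into [(Q_n)].  If [h] is an irreducible factor of
    [Q_n = h g], then the annihilator of [g e_1] is the prime ideal of the
    polynomials whose restriction to the [t]-axis is divisible by [h]
    ([annihilator_chain]).

    As [q] runs over the powers of [p], every [n] occurs.  [Q_n] has degree
    [n - 1], and [Q_m], [Q_n] are coprime when [m], [n] are
    ([dvdp_cheb_coprime]); so distinct prime numbers [n] give distinct
    associated primes.  Taking only [n = q] would not do: the polynomials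
    [Q_(p^e)] are powers of [t^2 - 4] for odd [p], and have only two roots. *)

Set Implicit Arguments.
Unset Strict Implicit.
Unset Printing Implicit Defensive.

Import GRing.Theory.

Local Open Scope ring_scope.
Local Open Scope classical_set_scope.

(** * Chebyshev polynomials *)

Section Chebyshev.
Variable R : comNzRingType.
Implicit Types s : R.

(** Two consecutive values are carried along so that the two-step recurrence
    is a structural recursion. *)
Fixpoint cheb_pair s (n : nat) : R * R :=
  if n is n'.+1 then
    let: (a, b) := cheb_pair s n' in (b, s * b - a)
  else (0, 1).

(** [cheb s n] is the Chebyshev value [U_(n-1) (s / 2)]. *)
Definition cheb s n := (cheb_pair s n).1.

Lemma cheb0 s : cheb s 0 = 0. Proof. by []. Qed.
Lemma cheb1 s : cheb s 1 = 1. Proof. by []. Qed.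
Lemma chebSS s n : cheb s n.+2 = s * cheb s n.+1 - cheb s n.
Proof. by rewrite /cheb /=; case: (cheb_pair s n). Qed.

(** The analogue of the addition formula for Fibonacci numbers: both sides
    satisfy the recurrence in [b].  It is what makes [n |-> cheb s n] compatible
    with divisibility of indices. *)
Lemma chebD s a b :
  cheb s (a + b).+1 = cheb s a.+1 * cheb s b.+1 - cheb s a * cheb s b.
Proof.
suff [] :
    cheb s (a + b).+1 = cheb s a.+1 * cheb s b.+1 - cheb s a * cheb s b /\
    cheb s (a + b).+2 = cheb s a.+1 * cheb s b.+2 - cheb s a * cheb s b.+1.
  by [].
elim: b => [|b [IH IHS]].
  rewrite addn0 !chebSS cheb0 cheb1 !mulr0 !mulr1 !subr0.
  by rewrite [cheb s a.+1 * s]mulrC.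
rewrite addnS; split=> //.
rewrite chebSS IHS IH [cheb s b.+3]chebSS [in X in _ = _ - X]chebSS.
by rewrite !mulrBr !(mulrCA s) !opprD !opprK addrACA.
Qed.

End Chebyshev.

Lemma rmorph_cheb (R S : comNzRingType) (f : {rmorphism R -> S}) s n :
  f (cheb s n) = cheb (f s) n.
Proof.
suff [] : f (cheb s n) = cheb (f s) n /\
          f (cheb s n.+1) = cheb (f s) n.+1 by [].
elim: n => [|n [IH IHS]]; first by rewrite !cheb0 !cheb1 rmorph0 rmorph1.
by split=> //; rewrite !chebSS rmorphB rmorphM IH IHS.
Qed.

Section ChebyshevPoly.
Variable k : fieldType.
Notation Q := (cheb (- 'X : {poly k})).

Lemma size_cheb n : size (Q n) = n.
Proof.
suff [] : size (Q n) = n /\ size (Q n.+1) = n.+1 by [].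
elim: n => [|n [IH IHS]]; first by rewrite cheb0 cheb1 size_poly0 size_poly1.
have nz : Q n.+1 != 0 by rewrite -size_poly_eq0 IHS.
have szX : size (- 'X * Q n.+1) = n.+2.
  by rewrite mulNr size_polyN mulrC size_mulX // IHS.
by split=> //; rewrite chebSS size_polyDl ?size_polyN szX // IH ltnW.
Qed.

Lemma dvdp_cheb_mull (h : {poly k}) m a : h %| Q m -> h %| Q (a * m).
Proof.
move=> hm; elim: a => [|a IH]; first by rewrite mul0n dvdp0.
rewrite mulSn; case: m => [|m] in hm IH *; first by rewrite muln0 dvdp0.
have -> : (m.+1 + a * m.+1 = (m + a * m.+1).+1)%N by [].
by rewrite chebD dvdp_sub ?(dvdp_mulr _ hm) ?(dvdp_mull _ IH).
Qed.

(** By Bezout, coprime indices have multiples that are consecutive integers; [h]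
    divides the polynomials at these two indices, and then the recurrence, run
    backwards, shows that it divides [cheb _ 1 = 1]. *)
Lemma dvdp_cheb_coprime (h : {poly k}) m n :
  coprime m n -> h %| Q m -> h %| Q n -> h %| 1.
Proof.
case: m => [|m] co hm hn.
  by move: co hn; rewrite /coprime gcd0n => /eqP ->; rewrite cheb1.
have [a _ /dvdnP[b E]] := Bezoutl n (ltn0Sn m).
rewrite (eqP co) add1n in E.
have ha := dvdp_cheb_mull a hn; have := dvdp_cheb_mull b hm.
rewrite -E; elim: (a * n)%N ha => [|i IH] hi hi1; first by rewrite cheb1 in hi1.
apply: IH => //; move: hi1.
by rewrite chebSS dvdp_subr ?dvdp_mull // => ?.
Qed.
End ChebyshevPoly.

(** * Irreducible factors and prime numbers *)

Lemma irredp_factor (k : fieldType) (p : {poly k}) :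
  (1 < size p)%N -> exists2 h : {poly k}, irreducible_poly h & h %| p.
Proof.
have [n] := ubnP (size p); elim: n p => // n IH p szn sz1.
have [irr|nirr] := pselect (irreducible_poly p); first by exists p.
have [d [d1 dp neq]] :
    exists d : {poly k}, [/\ size d != 1%N, d %| p & ~~ (d %= p)].
  apply: contrapT => H; apply: nirr; split=> // d d1 dp.
  by apply/negPn/negP => ne; apply: H; exists d.
have p0 : p != 0 by rewrite -size_poly_gt0 ltnW.
have [||h ih hd] := IH d.
- rewrite -ltnS; apply: leq_trans szn.
  by rewrite ltnS ltn_neqAle dvdp_leq // andbT dvdp_size_eqp.
- rewrite ltn_neqAle eq_sym d1 size_poly_gt0.
  by apply: contraNneq p0 => d0; move: dp; rewrite d0 dvd0p.
by exists h => //; apply: dvdp_trans hd dp.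
Qed.

Lemma infinite_primes : infinite_set [set n | prime n].
Proof.
move=> /finite_seqP[s Es]; have [m lt_m pm] := prime_above (\max_(i <- s) i).
have : [set` s] m by rewrite -Es.
by move=> /= ms; have := leq_bigmax_seq (F := id) m ms isT; rewrite leqNgt lt_m.
Qed.

(** * Ideals generated by a sequence *)

Section IdealGenTheory.
Variables (R : comNzRingType) (l : seq R).

Lemma ideal_genD a b :
  a \in ideal_gen l -> b \in ideal_gen l -> a + b \in ideal_gen l.
Proof.
by move=> la lb; have := (ideal_gen_submod l).2 1 a b la lb; rewrite scale1r.
Qed.

Lemma ideal_genMl c a : a \in ideal_gen l -> c * a \in ideal_gen l.
Proof.
have [l0 lD] := ideal_gen_submod l.
by move=> la; have := lD c a 0 la l0; rewrite addr0.
Qed.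

Lemma ideal_genB a b :
  a \in ideal_gen l -> b \in ideal_gen l -> a - b \in ideal_gen l.
Proof. by move=> la lb; rewrite -mulN1r ideal_genD ?ideal_genMl. Qed.

Lemma ideal_gen0 : 0 \in ideal_gen l.
Proof. exact: (ideal_gen_submod l).1. Qed.

Lemma ideal_gen_nth i : (i < size l)%N -> l`_i \in ideal_gen l.
Proof.
move=> lti; apply/ideal_genP; exists (fun j => (j == Ordinal lti)%:R).
rewrite (bigD1 (Ordinal lti)) //= eqxx mul1r big1 ?addr0 // => j /negPf ->.
by rewrite mul0r.
Qed.

End IdealGenTheory.

(** * The chain of monomials and its recurrence *)

(** The equation of the hypersurface in an arbitrary ring, so that the symmetry
    exchanging [(u, x)] and [(v, y)] can be used: it reduces [u] and [y] to [v]
    and [x] in [chain_socle]. *)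
Definition hyp_form {R : comNzRingType} (t u v x y : R) : R :=
  u ^+ 2 * x ^+ 2 + t * u * x * v * y + v ^+ 2 * y ^+ 2.

(** The monomial [e_i] for [i + j = n]; then [q = d.+1 + n].  The exponent
    [d.+1] rather than [d] expresses [n < q]: the room it leaves is what makes
    [x] and [y] annihilate [e_1]. *)
Definition chain {R : comNzRingType} (u v x y : R) d i j : R :=
  (u * v) ^+ d.+1 * ((u * x) ^+ i * (v * y) ^+ j).

Lemma chain_swap (R : comNzRingType) (u v x y : R) d i j :
  chain v u y x d j i = chain u v x y d i j.
Proof. by rewrite /chain (mulrC v u) [in LHS](mulrC (_ ^+ j)). Qed.

Lemma hyp_form_swap (R : comNzRingType) (t u v x y : R) :
  hyp_form t v u y x = hyp_form t u v x y.
Proof.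
rewrite /hyp_form [LHS](ACl (3*2*1)); congr (_ + _ + _).
by rewrite [LHS](ACl (1*4*5*2*3)).
Qed.

Section Chain.
Variables (R : comNzRingType) (l : seq R) (t u v x y : R) (d m : nat).
Notation J := (ideal_gen l).
Notation E := (chain u v x y d).
Hypothesis Jf : hyp_form t u v x y \in J.
Hypothesis Jv : v ^+ (d + m.+2) \in J.

Lemma chain_rel i j :
  E i.+2 j + t * E i.+1 j.+1 + E i j.+2 = E i j * hyp_form t u v x y.
Proof.
rewrite /chain /hyp_form -!exprMn !exprS expr0 !mulr1.
move: ((_ * _) ^+ d) ((_ * _) ^+ i) ((_ * _) ^+ j) => a b c.
rewrite !mulrDr; congr (_ + _ + _); rewrite !mulrA.
- by rewrite [RHS](ACl (1*2*3*6*7*8*9*4*5)).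
- by rewrite [RHS](ACl (6*1*2*3*7*8*4*9*10*5)).
- by rewrite [RHS](ACl (1*2*3*4*6*7*8*9*5)).
Qed.

Lemma chain0_mem : E 0 m.+1 \in J.
Proof.
rewrite /chain mul1r !exprMn.
by rewrite [_ * _](_ : _ = (u ^+ d.+1 * y ^+ m.+1) * v ^+ (d + m.+2))
  ?ideal_genMl // -addSnnS exprD !mulrA [LHS](ACl (1*4*2*3)).
Qed.

(** Modulo the ideal, the chain satisfies the recurrence of [cheb (- t)] and
    starts at [0]. *)
Lemma chain_cheb i j : (i + j = m.+1)%N ->
  E i j - cheb (- t) i * E 1 m \in J.
Proof.
suff H : (forall j, (i + j = m.+1)%N -> E i j - cheb (- t) i * E 1 m \in J) /\
  (forall j, (i.+1 + j = m.+1)%N -> E i.+1 j - cheb (- t) i.+1 * E 1 m \in J).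
  exact: H.1.
elim: i {j} => [|i [IH IHS]].
  split=> j; first by rewrite add0n cheb0 mul0r subr0 => ->; exact: chain0_mem.
  by rewrite add1n cheb1 mul1r => -[->]; rewrite subrr ideal_gen0.
split=> // j ij.
have /(ideal_genMl (- t)) J1 : E i.+1 j.+1 - cheb (- t) i.+1 * E 1 m \in J.
  by apply: IHS; rewrite -ij addnS.
have J0 : E i j.+2 - cheb (- t) i * E 1 m \in J.
  by apply: IH; rewrite -ij !addnS.
have := ideal_genMl (E i j) Jf; rewrite -chain_rel => J2.
suff <- : - t * (E i.+1 j.+1 - cheb (- t) i.+1 * E 1 m) +
    (E i.+2 j + t * E i.+1 j.+1 + E i j.+2 - (E i j.+2 - cheb (- t) i * E 1 m))
    = E i.+2 j - cheb (- t) i.+2 * E 1 m.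
  exact: ideal_genD J1 (ideal_genB J2 J0).
rewrite chebSS [in RHS]mulrBl !mulNr mulrBr -[t * _ * _]mulrA.
rewrite !opprB ?opprK -[E i.+2 j + _ + _ + _]addrA [E i j.+2 + _]addrC subrK.
set p := t * (_ * _); set b := t * _; set a := E i.+2 j; set c := cheb _ i * _.
by rewrite (addrAC a) (addrC (a + c)) subrKA [LHS]addrC addrA.
Qed.

(** Modulo the ideal, the whole chain consists of multiples of its element of
    index [1]. *)
Lemma chain_kill z i j : z * E 1 m \in J -> (i + j = m.+1)%N -> z * E i j \in J.
Proof.
move=> Jz /chain_cheb /(ideal_genMl z).
rewrite mulrBr (mulrCA z (cheb _ _)) => J1.
by have := ideal_genD J1 (ideal_genMl (cheb (- t) i) Jz); rewrite subrK.
Qed.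

Lemma chain_socle_v i j : (i + j = m.+1)%N -> v * E i j \in J.
Proof.
apply: chain_kill; rewrite /chain expr1 !exprMn.
rewrite [_ * _](_ : _ = (u ^+ d.+1 * (u * x) * y ^+ m) * v ^+ (d + m.+2)).
  exact: ideal_genMl.
have -> : (d + m.+2 = (d.+1 + m).+1)%N by rewrite addSn !addnS.
rewrite [v ^+ (_ + m).+1]exprS exprD !mulrA.
by rewrite [LHS](ACl (2*4*5*7*1*3*6)).
Qed.

Lemma chain_socle_x i j : (i + j = m.+1)%N -> x * E i j \in J.
Proof.
apply: chain_kill; rewrite /chain expr1.
(* The multiple [g f] continues the chain of [x e_i] to the index [-1], and its
   last two terms contain [v^q]. *)
set g := u ^+ d * v ^+ (d + m.+1) * y ^+ m.
have Jg : g * v \in J.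
  rewrite [g * v](_ : _ = u ^+ d * y ^+ m * v ^+ (d + m.+2)) ?ideal_genMl //.
  by rewrite /g (addnS d m.+1) exprSr !mulrA [LHS](ACl (1*3*2*4)).
have -> : x * ((u * v) ^+ d.+1 * (u * x * (v * y) ^+ m)) =
    g * hyp_form t u v x y - (t * u * x * y + v * y ^+ 2) * (g * v).
  have -> : (t * u * x * y + v * y ^+ 2) * (g * v) =
      g * (t * u * x * v * y + v ^+ 2 * y ^+ 2).
    clear Jg; clearbody g; rewrite mulrDl mulrDr !expr2 !mulrA; congr (_ + _).
    + by rewrite [LHS](ACl (5*1*2*3*6*4)).
    + by rewrite [LHS](ACl (4*1*5*2*3)).
  rewrite -mulrBr /hyp_form -[_ + _ + v ^+ 2 * _]addrA addrK /g.
  rewrite !exprMn addnS -addSn exprD !exprS.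
  by rewrite expr0 !mulr1 !mulrA [LHS](ACl (3*4*5*8*9*2*6*1*7)).
exact: ideal_genB (ideal_genMl _ Jf) (ideal_genMl _ Jg).
Qed.
End Chain.

Section ChainSocle.
Variables (R : comNzRingType) (l : seq R) (t u v x y : R) (d m : nat).
Notation J := (ideal_gen l).
Notation E := (chain u v x y d).
Hypothesis Jf : hyp_form t u v x y \in J.
Hypothesis Ju : u ^+ (d + m.+2) \in J.
Hypothesis Jv : v ^+ (d + m.+2) \in J.

(** Multiplication by [v] and [x] is treated above, by propagating from [e_0];
    the symmetry gives [u] and [y], by propagating from [e_n]. *)
Lemma chain_socle : [/\ u * E 1 m \in J, v * E 1 m \in J, x * E 1 m \in J
  & y * E 1 m \in J].
Proof.
have Jf' : hyp_form t v u y x \in J by rewrite hyp_form_swap.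
split; first 1 last; first 2 last.
- by rewrite -chain_swap (chain_socle_x Jf' Ju) // addn1.
- by rewrite -chain_swap (chain_socle_v Jf' Ju) // addn1.
- by rewrite (chain_socle_v Jf Jv) // add1n.
- by rewrite (chain_socle_x Jf Jv) // add1n.
Qed.

(** This is [e_n = 0] read through [e_n = Q_n e_1]. *)
Lemma chain_annihilator : cheb (- t) m.+1 * E 1 m \in J.
Proof.
have Jf' : hyp_form t v u y x \in J by rewrite hyp_form_swap.
have J0 : E m.+1 0 \in J by rewrite -chain_swap; exact: chain0_mem.
have := ideal_genB J0 (chain_cheb Jf Jv (addn0 m.+1)).
by rewrite opprB addrC subrK.
Qed.
End ChainSocle.

(** * A functional detecting the annihilator *)

Section LinearExtension.
Variables (R : nzRingType) (V : lmodType R) (n : nat) (w : 'X_{1..n} -> V).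

Definition mlinext (p : {mpoly R[n]}) : V :=
  \sum_(m <- msupp p) p@_m *: w m.

(** Summing over a common bounded set of monomials, instead of the support,
    is what makes linearity visible. *)
Lemma mlinextE (p : {mpoly R[n]}) b : (msize p <= b)%N ->
  mlinext p = \sum_(m : 'X_{1..n < b}) p@_m *: w m.
Proof.
move=> lepb; pose I : subFinType _ := 'X_{1..n < b}.
rewrite /mlinext (big_mksub I) ?msupp_uniq //=; first last.
  by move=> m /msize_mdeg_lt /leq_trans; apply.
by rewrite big_rmcond //= => m /memN_msupp_eq0 ->; rewrite scale0r.
Qed.

Lemma mlinext_is_linear : linear mlinext.
Proof.
move=> c p q; pose b := maxn (msize p) (maxn (msize q) (msize (c *: p + q))).
rewrite !(@mlinextE _ b) /b ?leq_max ?leqnn ?orbT //.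
rewrite scaler_sumr -big_split /=; apply: eq_bigr => m _.
by rewrite linearP scalerDl scalerA.
Qed.

HB.instance Definition _ :=
  GRing.isLinear.Build R {mpoly R[n]} V _ mlinext mlinext_is_linear.

Lemma mlinextX m : mlinext 'X_[m] = w m.
Proof. by rewrite /mlinext msuppX big_seq1 mcoeffX eqxx scale1r. Qed.

End LinearExtension.

Section Detect.
Variables (k : fieldType) (d m : nat).
Notation A := {mpoly k[5]}.
Notation Q := (cheb (- 'X : {poly k})).
Notation it := (@Ordinal 5 0 isT).
Notation iu := (@Ordinal 5 1 isT).
Notation iv := (@Ordinal 5 2 isT).
Notation ix := (@Ordinal 5 3 isT).
Notation iy := (@Ordinal 5 4 isT).

(** The monomials [t^a e_i], whose index [i] is the exponent of [x]. *)
Definition on_chain (mu : 'X_{1..5}) : bool :=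
  [&& mu iu == d.+1 + mu ix, mu iv == d.+1 + mu iy & mu ix + mu iy == m.+1]%N.

(** The value forced on [t^a e_i] by the recurrence and by [e_1 |-> 1]; the
    other graded pieces are sent to [0]. *)
Definition weight (mu : 'X_{1..5}) : {poly k} :=
  if on_chain mu then Q (mu ix) * 'X^(mu it) else 0.

Definition detect : A -> {poly k} := mlinext weight.
HB.instance Definition _ := GRing.Linear.on detect.

Lemma detectX mu : detect 'X_[mu] = weight mu.
Proof. exact: mlinextX. Qed.

Lemma detect_mull_ind (a : A) (P : {poly k} -> Prop) :
  P 0 -> (forall c p q, P p -> P q -> P (c *: p + q)) ->
  (forall mu, P (detect ('X_[mu] * a))) -> forall p, P (detect (p * a)).
Proof.
move=> P0 PD PX p; elim/mpolyind: p => [|c mu p _ _ IH].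
  by rewrite mul0r linear0.
by rewrite mulrDl -scalerAl linearP; apply: PD.
Qed.

Let exps (a b c e f : nat) : 'X_{1..5} :=
  (U_(it) *+ a + U_(iu) *+ b + U_(iv) *+ c + U_(ix) *+ e + U_(iy) *+ f)%MM.

Let mpolyX_exps a b c e f :
  tA k ^+ a * uA k ^+ b * vA k ^+ c * xA k ^+ e * yA k ^+ f =
    'X_[exps a b c e f].
Proof. by rewrite !mpolyXD -!mpolyXn. Qed.

Lemma detectMt p : detect (tA k * p) = 'X * detect p.
Proof.
rewrite mulrC; elim/mpolyind: p => [|c mu p _ _ IH].
  by rewrite mul0r !linear0 mulr0.
rewrite mulrDl -scalerAl linearP [in RHS]linearP /= IH mulrDr -scalerAr.
congr (_ *: _ + _).
rewrite /tA -mpolyXD !detectX /weight /on_chain !mnmDE !mnm1E /= !addn0.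
by case: ifP => _; rewrite ?mulr0 // addn1 exprSr mulrA mulrC.
Qed.

(** The three monomials of a monomial multiple of [f] lie on the chain
    simultaneously, and then their weights cancel by the recurrence. *)
Lemma detect_hyp p :
  detect (p * hyp_form (tA k) (uA k) (vA k) (xA k) (yA k)) = 0.
Proof.
apply: (detect_mull_ind (P := fun z => z = 0)) => // [c p' q -> ->|mu].
  by rewrite scaler0 addr0.
have -> : hyp_form (tA k) (uA k) (vA k) (xA k) (yA k) =
  'X_[exps 0 2 0 2 0] + 'X_[exps 1 1 1 1 1] + 'X_[exps 0 0 2 0 2].
  rewrite -!mpolyX_exps !expr0 !expr1 !mul1r !mulr1 /hyp_form.
  by congr (_ + _ + _); rewrite ?mulr1 ?mul1r // [LHS](ACl (1*2*4*3*5)).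
pose C := [&& mu iu == d.+1 + mu ix, mu iv == d.+1 + mu iy
  & mu ix + mu iy + 2 == m.+1]%N.
have C1 : on_chain (mu + exps 0 2 0 2 0) = C.
  by rewrite /on_chain /C !(mnmDE, mulmnE, mnm1E) /=; lia.
have C2 : on_chain (mu + exps 1 1 1 1 1) = C.
  by rewrite /on_chain /C !(mnmDE, mulmnE, mnm1E) /=; lia.
have C3 : on_chain (mu + exps 0 0 2 0 2) = C.
  by rewrite /on_chain /C !(mnmDE, mulmnE, mnm1E) /=; lia.
rewrite !mulrDr -!mpolyXD !linearD /= !detectX /weight C1 C2 C3.
rewrite !(mnmDE, mulmnE, mnm1E) /= !(muln0, muln1, mul0n, mul1n, addn0, add0n).
case: {C1 C2 C3}C; last by rewrite !addr0.
rewrite addn2 addn1 chebSS addn1 exprS mulrBl !mulNr mulrCA -mulrA.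
by rewrite addrAC subrK addNr.
Qed.

(** Divisibility by [u^q] forces the index [n] on the chain, and divisibility by
    [v^q] the index [0]; no monomial of the chain is divisible by [x^q] or
    [y^q], as [n < q]. *)
Lemma detect_power p :
 [/\ Q m.+1 %| detect (p * uA k ^+ (d + m.+2)),
     Q m.+1 %| detect (p * vA k ^+ (d + m.+2)),
     Q m.+1 %| detect (p * xA k ^+ (d + m.+2)) &
     Q m.+1 %| detect (p * yA k ^+ (d + m.+2))].
Proof.
split; apply: (detect_mull_ind (P := fun z => Q m.+1 %| z))
  => [|c p' q p'Q qQ|mu]; rewrite ?dvdp0 //.
1,3,5,7: by rewrite dvdp_add // ?(dvdp_trans p'Q) // -mul_polyC dvdp_mull.
all: rewrite mpolyXn -mpolyXD detectX /weight /on_chain.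
all: rewrite !(mnmDE, mulmnE, mnm1E) /=
  !(muln0, muln1, mul0n, mul1n, addn0, add0n).
- case: ifP => [/and3P[/eqP Eu _ /eqP Exy]|_]; last exact: dvdp0.
  by rewrite (_ : mu ix = m.+1) ?dvdp_mulr //; lia.
- case: ifP => [/and3P[_ /eqP Ev /eqP Exy]|_]; last exact: dvdp0.
  by rewrite (_ : mu ix = 0%N) ?cheb0 ?mul0r ?dvdp0 //; lia.
- by case: ifP => [/and3P[_ _ /eqP Exy]|_]; [lia | exact: dvdp0].
- by case: ifP => [/and3P[_ _ /eqP Exy]|_]; [lia | exact: dvdp0].
Qed.

Lemma detect_chain (g : {poly k}) :
  detect (horner_alg (tA k) g *
    chain (uA k) (vA k) (xA k) (yA k) d 1 m) = g.
Proof.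
elim/poly_ind: g => [|g c IH]; first by rewrite rmorph0 mul0r linear0.
rewrite rmorphD rmorphM /= horner_algX horner_algC mulrDl linearD /=.
rewrite [_ * tA k]mulrC -mulrA detectMt IH mulrC; congr (_ + _).
rewrite mulr_algl linearZ /= -mul_polyC -[RHS]mulr1; congr (_ * _).
have -> : chain (uA k) (vA k) (xA k) (yA k) d 1 m =
  'X_[exps 0 (d.+1 + 1) (d.+1 + m) 1 m].
  rewrite -mpolyX_exps /chain !exprMn !exprD expr0 mul1r !mulrA.
  by rewrite [LHS](ACl (1*3*2*5*4*6)).
rewrite detectX /weight /on_chain.
rewrite !(mnmDE, mulmnE, mnm1E) /= !(muln0, muln1, mul0n, mul1n, addn0, add0n).
by rewrite !eqxx /= cheb1 expr0 mulr1.
Qed.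
End Detect.

(** * Membership in the quotients *)

Section Quotients.
Local Open Scope quotient_scope.

Lemma pi_quot_module_eq0 (R : comNzRingType) (s : seq R) (a : R) :
  ((\pi_(submod_quot (ideal_submod s)) a : quot_module s) == 0) =
  (a \in ideal_gen s).
Proof.
have -> : (0 : quot_module s) = \pi_(submod_quot (ideal_submod s)) 0.
  by rewrite raddf0.
by rewrite -Quotient.idealrBE subr0.
Qed.

Lemma ideal_gen_nil (R : comNzRingType) (a : R) :
  (a \in ideal_gen [::]) = (a == 0).
Proof.
apply/ideal_genP/eqP => [[c ->]|->]; first by rewrite big_ord0.
by exists (fun=> 0); rewrite big_ord0.
Qed.

Lemma ideal_gen_cons (R : comNzRingType) (b : R) l a :
  a \in ideal_gen (b :: l) <-> exists c, a - c * b \in ideal_gen l.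
Proof.
split=> [/ideal_genP[c ->]|[c /ideal_genP[e E]]].
  exists (c ord0); rewrite big_ord_recl /= addrC addKr.
  by apply/ideal_genP; exists (fun i => c (lift ord0 i)).
apply/ideal_genP; exists (fun i => oapp e c (unlift ord0 i)).
rewrite big_ord_recl unlift_none /= -[a](subrKC (c * b)) E; congr (_ + _).
by apply: eq_bigr => i _; rewrite liftK.
Qed.

(** Ideals of the hypersurface ring are ideals of the polynomial ring that
    contain its equation.  The equation is appended at the end of the list so
    that the induction peels off the other generators. *)
Lemma pi_mem_ideal_gen (k : fieldType) (l : seq {mpoly k[5]}) a :
  (\pi_(hyp_ring k) a \in ideal_gen [seq \pi_(hyp_ring k) b | b <- l]) <->
  (a \in ideal_gen (l ++ [:: hyp_eq k])).
Proof.
elim: l a => [|b l IH] a.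
  rewrite /= ideal_gen_nil -[0](rmorph0 \pi_(hyp_ring k)).
  by rewrite -Quotient.idealrBE subr0.
rewrite /= !ideal_gen_cons; split=> -[c].
  rewrite -[c]reprK -rmorphM -rmorphB => /IH J; by exists (repr c).
by move=> /IH J; exists (\pi c); rewrite -rmorphM -rmorphB.
Qed.
End Quotients.

(** * Annihilators of the multiples of the first chain element *)

Section Annihilators.
Variables (k : fieldType) (d m : nat).
Notation A := {mpoly k[5]}.
Notation Q := (cheb (- 'X : {poly k})).
Notation inA := (horner_alg (tA k)).

(** Restriction to the [t]-axis [u = v = x = y = 0]. *)
Definition axis : A -> {poly k} :=
  mmap polyC (fun i : 'I_5 => if i == 0 :> nat then 'X else 0).
HB.instance Definition _ := GRing.RMorphism.on axis.

Definition frobenius_gens q : seq A :=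
  [:: uA k ^+ q; vA k ^+ q; xA k ^+ q; yA k ^+ q].

Notation J := (ideal_gen (frobenius_gens (d + m.+2) ++ [:: hyp_eq k])).
Notation E := (chain (uA k) (vA k) (xA k) (yA k) d 1 m).

Lemma detect_mem p : p \in J -> Q m.+1 %| detect d m p.
Proof.
move=> /ideal_gen_cons[a /ideal_gen_cons[b /ideal_gen_cons[c]]].
move=> /ideal_gen_cons[e /ideal_gen_cons[f]]; rewrite ideal_gen_nil.
rewrite subr_eq0 !subr_eq => /eqP ->; rewrite !linearD /= detect_hyp add0r.
have [ua _ _ _] := detect_power d m a; have [_ vb _ _] := detect_power d m b.
have [_ _ xc _] := detect_power d m c; have [_ _ _ ye] := detect_power d m e.
exact: dvdp_add (dvdp_add (dvdp_add ye xc) vb) ua.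
Qed.

Lemma hyp_eq_mem : hyp_form (tA k) (uA k) (vA k) (xA k) (yA k) \in J.
Proof. exact: (@ideal_gen_nth _ _ 4). Qed.

Lemma u_power_mem : uA k ^+ (d + m.+2) \in J.
Proof. exact: (@ideal_gen_nth _ _ 0). Qed.

Lemma v_power_mem : vA k ^+ (d + m.+2) \in J.
Proof. exact: (@ideal_gen_nth _ _ 1). Qed.

(** The polynomials [p] acting on [e_1] as [axis p] form a subring, which
    contains [t] trivially and [u], [v], [x], [y] because they kill [e_1]. *)
Lemma axis_mem p : p * E - inA (axis p) * E \in J.
Proof.
have [Ju Jv Jx Jy] := chain_socle hyp_eq_mem u_power_mem v_power_mem.
have SD a b : a * E - inA (axis a) * E \in J ->
    b * E - inA (axis b) * E \in J ->
    (a + b) * E - inA (axis (a + b)) * E \in J.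
  by move=> Ja Jb; rewrite !rmorphD !mulrDl opprD addrACA ideal_genD.
have SM a b : a * E - inA (axis a) * E \in J ->
    b * E - inA (axis b) * E \in J ->
    (a * b) * E - inA (axis (a * b)) * E \in J.
  move=> Ja Jb.
  have := ideal_genD (ideal_genMl b Ja) (ideal_genMl (inA (axis a)) Jb).
  by rewrite !mulrBr !mulrA [b * a]mulrC [b * _]mulrC subrKA -!rmorphM.
have SC c : c%:MP * E - inA (axis c%:MP) * E \in J.
  by rewrite /axis mmapC horner_algC -mul_mpolyC mulr1 subrr ideal_gen0.
have SX i : 'X_i * E - inA (axis 'X_i) * E \in J.
  rewrite /axis mmapX mmap1U; case: i => -[|[|[|[|[|i]]]]] lti //=;
    rewrite (bool_irrelevance lti isT) ?horner_algX ?rmorph0 ?mul0r ?subr0 //.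
  by rewrite subrr ideal_gen0.
elim/mpolyind: p => [|c mu p _ _ IH]; first exact: (SC 0).
apply: SD IH; rewrite -mul_mpolyC; apply: (SM _ _ (SC c)).
rewrite mpolyXE_id.
apply: (big_rec (fun q => q * E - inA (axis q) * E \in J)) => [|i q _ IHq].
  exact: (SC 1).
apply: (SM _ _ _ IHq); elim: (mu i) => [|n IHn]; first exact: (SC 1).
by rewrite exprS; exact: SM _ _ (SX i) IHn.
Qed.

(** [p g e_1 = axis p g e_1] vanishes exactly when [Q_n = h g] divides
    [axis p g]. *)
Lemma annihilator_chain (g h : {poly k}) p : g != 0 -> Q m.+1 = h * g ->
  (p * (inA g * E) \in J) = (h %| axis p).
Proof.
move=> g0 Qhg.
have -> : (p * (inA g * E) \in J) = (inA (axis p * g) * E \in J).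
  have := ideal_genMl (inA g) (axis_mem p); rewrite mulrBr.
  rewrite mulrCA [X in _ - X]mulrA -rmorphM [g * _]mulrC => J0.
  apply/idP/idP => J1; last by have := ideal_genD J0 J1; rewrite subrK.
  by have := ideal_genB J1 J0; rewrite opprB addrC subrK.
rewrite -(dvdp_mul2r _ _ g0) -Qhg; apply/idP/idP.
  by move=> /detect_mem; rewrite detect_chain.
move=> /dvdpP[c ->]; rewrite rmorphM -mulrA ideal_genMl //.
rewrite rmorph_cheb rmorphN /= horner_algX.
exact: (chain_annihilator hyp_eq_mem u_power_mem v_power_mem).
Qed.
End Annihilators.

(** * The associated primes *)

Local Open Scope quotient_scope.

Lemma irredp_dvd_mul (k : fieldType) (h a b : {poly k}) :
  irreducible_poly h -> h %| a * b -> (h %| a) || (h %| b).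
Proof.
move=> irr hab; have [//|na] := boolP (h %| a).
by rewrite -(@Gauss_dvdpr _ b a) // irreducible_poly_coprime.
Qed.

Lemma axis_horner_alg (k : fieldType) (g : {poly k}) :
  axis (horner_alg (tA k) g) = g.
Proof.
elim/poly_ind: g => [|g c IH]; first by rewrite !rmorph0.
rewrite !rmorphD !rmorphM /= IH horner_algX horner_algC -mul_mpolyC mulr1.
by rewrite /axis mmapC mmapX mmap1U.
Qed.

(** The last clause describes the prime by [h]; it is kept in the conclusion
    because it tells apart the primes obtained from different [m]. *)
Lemma exists_Ass (k : fieldType) (d m : nat) (q := (d + m.+2)%N) :
  (0 < m)%N ->
  exists2 P,
    Ass (quot_module [:: uR k ^+ q; vR k ^+ q; xR k ^+ q; yR k ^+ q]) P &
    exists h : {poly k}, [/\ irreducible_poly h, h %| cheb (- 'X) m.+1 &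
      forall r, (\pi_(hyp_ring k) r \in P) = (h %| axis r)].
Proof.
move=> m0; have [|h irr hQ] := @irredp_factor k (cheb (- 'X) m.+1).
  by rewrite size_cheb.
have [g Qgh] := dvdpP _ _ hQ; rewrite mulrC in Qgh.
have g0 : g != 0.
  apply: contraTneq (ltn0Sn m) => g0.
  by rewrite -(size_cheb k m.+1) Qgh g0 mulr0 size_poly0.
set s := (X in quot_module X).
have sE : s = [seq \pi_(hyp_ring k) b | b <- frobenius_gens k q].
  by rewrite /s /= !rmorphXn.
pose a := horner_alg (tA k) g * chain (uA k) (vA k) (xA k) (yA k) d 1 m.
pose M : quot_module s :=
  \pi_(submod_quot (ideal_submod s)) (\pi_(hyp_ring k) a).
have annE r : (\pi_(hyp_ring k) r \in ann M) = (h %| axis r).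
  rewrite -(annihilator_chain d r g0 Qgh) /ann unfold_in /= /M.
  rewrite -[_ *: _]pi_scale pi_quot_module_eq0 /=.
  rewrite -[_ *: _]/(\pi_(hyp_ring k) r * \pi_(hyp_ring k) a) -rmorphM sE.
  apply/idP/idP => [|J0]; first exact: (iffLR (pi_mem_ideal_gen _ _)).
  exact: (iffRL (pi_mem_ideal_gen _ _)).
exists (ann M); last by exists h.
split; last by exists M.
have h1 : ~~ (h %| 1) by rewrite dvdp1; case: irr => + _; case: ltngtP.
split; [split|].
- by rewrite -(rmorph0 \pi_(hyp_ring k)) annE rmorph0 dvdp0.
- by rewrite -(rmorph1 \pi_(hyp_ring k)) annE rmorph1.
- move=> c v w; rewrite -[c]reprK -[v]reprK -[w]reprK !annE => hv hw.
  by rewrite -rmorphM -rmorphD annE rmorphD rmorphM dvdp_add ?dvdp_mull.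
- move=> v w; rewrite -[v]reprK -[w]reprK -rmorphM !annE rmorphM.
  exact: irredp_dvd_mul.
Qed.

Theorem theorem4p3 (k : fieldType) (p : nat) (hp : p \in [pchar k]) :
  infinite_set
    (\bigcup_(q in [set (p ^ e)%N | e in [set: nat]])
       Ass (quot_module [:: uR k ^+ q; vR k ^+ q; xR k ^+ q; yR k ^+ q])).
Proof.
set S := \bigcup_(q in _) _ => finS.
have /choice[F FP] n : exists P : {pred hyp_ring k}, prime n -> S P /\
    exists h : {poly k}, [/\ irreducible_poly h, h %| cheb (- 'X) n &
      forall r, (\pi_(hyp_ring k) r \in P) = (h %| axis r)].
  have [pn|] := boolP (prime n); last by exists (fun=> false).
  case: n pn => [//|[//|n]] pn.
  have p1 := prime_gt1 (pcharf_prime hp).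
  (* Any exponent [e] with [n.+2 < p ^ e] will do; [e = n.+3] has it. *)
  have [P PA Ph] := @exists_Ass k (p ^ n.+3 - n.+3) n.+1 isT.
  exists P => _; split=> //; exists (p ^ n.+3)%N; first by exists n.+3.
  by move: PA; rewrite subnK // ltnW // ltn_expl.
have Finj : {in [set n | prime n] &, injective F}.
  move=> a b; rewrite !inE => pa pb Fab; apply/eqP/negPn/negP => neq.
  have [_ [h [irr ha hP]]] := FP a pa; have [_ [h' [irr' hb hP']]] := FP b pb.
  have hh' : h' %| h.
    by rewrite -[h in _ %| h]axis_horner_alg -hP' -Fab hP axis_horner_alg.
  have := dvdp_cheb_coprime _ (dvdp_trans hh' ha) hb.
  rewrite prime_coprime // dvdn_prime2 // => /(_ neq); rewrite dvdp1.
  by case: irr' => + _; case: ltngtP.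
apply: infinite_primes; rewrite -(eq_finite_set (inj_card_eq Finj)).
by apply: sub_finite_set finS => _ [n /FP[SP _] <-].
Qed.
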